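(* Let $(\mathbf f^n)_{n\ge 0}$, $(\mathbf E_1^n,\mathbf E_2^n,\mathbf B_3^n)_{n\ge 0}$ be the sequences of distribution tensors and fields produced by the LoMaC (Local Macroscopic Conservative) low rank solver for the 1D2V Vlasov-Maxwell system described in the context. Then the solver locally conserves the macroscopic mass, momentum and energy. That is, for each $n\ge 0$ and $j=1,\dots,N_{x_1}$ let $$\rho_j^n=\langle \mathbf f^n_j,\mathbf 1\otimes\mathbf 1\rangle,\quad J_{1,j}^n=\langle \mathbf f^n_j,\mathbf v_1\otimes\mathbf 1\rangle,\quad J_{2,j}^n=\langle \mathbf f^n_j,\mathbf 1\otimes\mathbf v_2\rangle,\quad \kappa_j^n=\tfrac12\langle \mathbf f^n_j,\mathbf v_1^2\otimes\mathbf 1+\mathbf 1\otimes\mathbf v_2^2\rangle$$ be the discrete charge, current and kinetic energy densities of $\mathbf f^n$, and let $$P_{1,j}^n=J_{1,j}^n+E_{2,j}^nB_{3,j}^n,\quad P_{2,j}^n=J_{2,j}^n-E_{1,j}^nB_{3,j}^n,\quad e_j^n=\kappa_j^n+\tfrac12\left(|E_{1,j}^n|^2+|E_{2,j}^n|^2+|B_{3,j}^n|^2\right).$$ Then for all $n\ge 2$ and all $j$, the vector $U_j^n=(\rho_j^n,P_{1,j}^n,P_{2,j}^n,e_j^n)^\top$ satisfies exactly the flux-difference discretization of the macroscopic mass, momentum and energy equations $$U_j^{n+1}=\tfrac14U_j^{n-2}+\tfrac34U_j^n+\tfrac32\Delta t\left(-\frac1{h_{x_1}}\left(\hat F^n_{j+\frac12}-\hat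 F^n_{j-\frac12}\right)+S_j^n\right),$$ where $\hat F^n_{j+\frac12}$ are the single-valued numerical fluxes at the cell interfaces and $S_j^n$ the discrete source terms defined in the context.
   Context: **Continuous system.** The 1D2V Vlasov-Maxwell system for $f(x_1,v_1,v_2,t)$, $E_1,E_2,B_3$ (functions of $x_1,t$) with constant ion background density $\rho_i$ is $$\partial_t f+v_1\partial_{x_1}f+(E_1+v_2B_3)\partial_{v_1}f+(E_2-v_1B_3)\partial_{v_2}f=0,$$ $$\partial_tE_1=-J_1,\quad \partial_tE_2=-\partial_{x_1}B_3-J_2,\quad \partial_tB_3=-\partial_{x_1}E_2,\quad \partial_{x_1}E_1=\rho-\rho_i,$$ with $\rho=\int f\,dv_1dv_2$ and $J_k=\int v_kf\,dv_1dv_2$. With $\kappa=\frac12\int(v_1^2+v_2^2)f\,dv_1dv_2$, $P_1=J_1+E_2B_3$, $P_2=J_2-E_1B_3$, $e=\kappa+\frac12(E_1^2+E_2^2+B_3^2)$, $\sigma_1=\int v_1^2f\,dv_1dv_2$, $\sigma_2=\int v_1v_2f\,dv_1dv_2$, $Q_1=\frac12\int v_1(v_1^2+v_2^2)f\,dv_1dv_2$, its macroscopic mass, momentum and energy equations are $U_t+F_{x_1}=S$ with $U=(\rho,P_1,P_2,e)^\top$, $F=(J_1,\sigma_1,\sigma_2,Q_1)^\top$ and $$S=\left(0,\ \tfrac12\partial_{x_1}(E_1^2-E_2^2-B_3^2)+\rho_iE_1,\ \partial_{x_1}(E_1E_2)+\rho_iE_2,\ \partial_{x_1}(E_2B_3)\right)^\top.$$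 **Discretization.** Use a uniform grid with $N_{x_1}$ points and mesh size $h_{x_1}$ in $x_1$ (spatial indices are periodic modulo $N_{x_1}$), and uniform grids on $[-v_{1,\max},v_{1,\max}]$ and $[-v_{2,\max},v_{2,\max}]$ (endpoints included) with mesh sizes $h_{v_1},h_{v_2}$ and $N_{v_1},N_{v_2}$ points; the $v_1$ and $v_2$ grids are taken identical. $\mathbf v_k\in\mathbb R^{N_{v_k}}$ is the vector of grid coordinates, $\mathbf 1$ (also $\mathbf 1_{v_k}$) the vector of ones; powers of vectors and $\star$ are element-wise. For $\mathbf f\in\mathbb R^{N_{x_1}\times N_{v_1}\times N_{v_2}}$, $\mathbf f_j\in\mathbb R^{N_{v_1}\times N_{v_2}}$ is its slice at the $j$-th spatial point. On $\mathbb R^{N_{v_1}\times N_{v_2}}$ let $$\langle\mathbf g,\mathbf h\rangle=h_{v_1}h_{v_2}\sum_{j_1,j_2}g_{j_1,j_2}h_{j_1,j_2},\qquad \langle\mathbf g,\mathbf h\rangle_{\mathbf w}=\langle \mathbf w\star\mathbf g,\mathbf h\rangle,$$ where $\mathbf w=\mathbf w^{(1)}\otimes\mathbf w^{(2)}$ is the grid sampling of a positive, exponentially decaying weight $w(v_1,v_2)=w^{(1)}(v_1)w^{(2)}(v_2)$, the same in both directions (e.g. $w=e^{-v_1^2/2}e^{-v_2^2/2}$). $D_{x_1},D_{v_1},D_{v_2}$ denote the Fourier spectral collocation differentiation operators. **Projection.** Let $\mathcal N=\mathrm{span}\{\mathbf 1\otimes\mathbf 1,\ \mathbf v_1\otimes\mathbf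 1,\ \mathbf 1\otimes\mathbf v_2,\ \mathbf v_1^2\otimes\mathbf 1+\mathbf 1\otimes\mathbf v_2^2\}$. With $\langle\mathbf a,\mathbf b\rangle_{\mathbf w^{(1)}}=h_{v_1}\sum_ja_jb_jw^{(1)}_j$, put $c=\langle\mathbf 1,\mathbf v_1^2\rangle_{\mathbf w^{(1)}}/\langle\mathbf 1,\mathbf 1\rangle_{\mathbf w^{(1)}}$ and let $c_1,c_2,c_3$ be the $\langle\cdot,\cdot\rangle_{\mathbf w^{(1)}}$-norms of $\mathbf 1$, $\mathbf v_1$, $\mathbf v_1^2-c\mathbf 1$. The weight and grid are such that $$\mathbf V_1=\tfrac1{c_1^2}\mathbf 1\otimes\mathbf 1,\quad \mathbf V_2=\tfrac1{c_1c_2}\mathbf v_1\otimes\mathbf 1,\quad \mathbf V_3=\tfrac1{c_1c_2}\mathbf 1\otimes\mathbf v_2,\quad \mathbf V_4=\tfrac1{\sqrt2\,c_1c_3}\left((\mathbf v_1^2-c\mathbf 1)\otimes\mathbf 1+\mathbf 1\otimes(\mathbf v_2^2-c\mathbf 1)\right)$$ is an orthonormal basis of $\mathcal N$ for $\langle\cdot,\cdot\rangle_{\mathbf w}$ (as holds for the Gaussian weight). The (rescaled) projection is, slice by slice in $j$, $P_{\mathcal N}(\mathbf f)_j=\sum_{l=1}^4\langle\mathbf f_j,\mathbf V_l\rangle\,(\mathbf w\star\mathbf V_l)$. $\mathcal T_\varepsilon$ is the standard hierarchical HOSVD truncation with threshold $\varepsilon$ of a tensor in the hierarchical Tucker (HT)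 format with dimension tree $\{(1,2,3);(1),(2,3);(2),(3)\}$, the dimensions being $x_1,v_1,v_2$. All distribution tensors are stored in this format. $\sqrt{\mathbf w}\,\star$ and $\frac1{\sqrt{\mathbf w}}\,\star$ act on the velocity indices. **The LoMaC solver.** Starting data $\mathbf f^n$ and fields are given at levels $n=0,1,2$, with the macroscopic values $U^n$ at these levels being those determined by $\mathbf f^n$ and the fields through the formulas in the claim. One step $n\to n+1$ ($n\ge2$): 1. *Add basis.* Set $$\mathbf f^{n+1,*}=\tfrac14\mathbf f^{n-2}+\tfrac34\mathbf f^n-\tfrac32\Delta t\left(v_1D_{x_1}\mathbf f^n+E_1^nD_{v_1}\mathbf f^n+v_2B_3^nD_{v_1}\mathbf f^n+E_2^nD_{v_2}\mathbf f^n-v_1B_3^nD_{v_2}\mathbf f^n\right),$$ with $v_k,E_k^n,B_3^n$ acting by pointwise multiplication. 2. *Truncate the remainder.* Set $\mathbf f_2=\mathbf f^{n+1,*}-P_{\mathcal N}(\mathbf f^{n+1,*})$ and form $(I-P_{\mathcal N})\left(\sqrt{\mathbf w}\star\mathcal T_\varepsilon\left(\frac1{\sqrt{\mathbf w}}\star\mathbf f_2\right)\right)$. 3. *Macroscopic update (kinetic flux vector splitting).* With $\mathbf v_1^+=\max(\mathbf v_1,0)$, $\mathbf v_1^-=\min(\mathbf v_1,0)$ set $$F_j^{n,\pm}=\left\langle\mathbf f^n_j,\left(\mathbf v_1^\pm\otimes\mathbf 1,\ (\mathbf v_1^\pm)^2\otimes\mathbf 1,\ \mathbf v_1^\pm\otimes\mathbf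 v_2,\ \tfrac12(\mathbf v_1^\pm)^3\otimes\mathbf 1+\tfrac12\mathbf v_1^\pm\otimes\mathbf v_2^2\right)^\top\right\rangle\in\mathbb R^4,$$ $$\hat F^{n,+}_{j+\frac12}=\tfrac1{30}F^{n,+}_{j-2}-\tfrac{13}{60}F^{n,+}_{j-1}+\tfrac{47}{60}F^{n,+}_j+\tfrac9{20}F^{n,+}_{j+1}-\tfrac1{20}F^{n,+}_{j+2},$$ $$\hat F^{n,-}_{j+\frac12}=-\tfrac1{20}F^{n,-}_{j-1}+\tfrac9{20}F^{n,-}_j+\tfrac{47}{60}F^{n,-}_{j+1}-\tfrac{13}{60}F^{n,-}_{j+2}+\tfrac1{30}F^{n,-}_{j+3},$$ and $\hat F^n_{j+\frac12}=\hat F^{n,+}_{j+\frac12}+\hat F^{n,-}_{j+\frac12}$. $S_j^n$ is the value at the $j$-th grid point of $S$ evaluated with the fields at level $n$, the derivatives $\partial_{x_1}$ being replaced by the spectral operator $D_{x_1}$. The solver stores macroscopic values updated by $$(\rho_j^{n+1,M},P_{1,j}^{n+1,M},P_{2,j}^{n+1,M},e_j^{n+1,M})^\top=\tfrac14U_j^{n-2,M}+\tfrac34U_j^{n,M}+\tfrac32\Delta t\left(-\tfrac1{h_{x_1}}\left(\hat F^n_{j+\frac12}-\hat F^n_{j-\frac12}\right)+S_j^n\right),$$ where $U^{m,M}$ are the stored macroscopic values at level $m$ (equal to $U^m$ for $m=0,1,2$). 4. *Fields.* $\mathbf E_1^{n+1}$ is obtained from Poisson's equation (Gauss's law) with charge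 density $\rho^{n+1,M}$; $\mathbf E_2^{n+1},\mathbf B_3^{n+1}$ are obtained by a numerical update of Maxwell's equations. 5. *Correction.* Set $J_{1,j}^{n+1,M}=P_{1,j}^{n+1,M}-E_{2,j}^{n+1}B_{3,j}^{n+1}$, $J_{2,j}^{n+1,M}=P_{2,j}^{n+1,M}+E_{1,j}^{n+1}B_{3,j}^{n+1}$, $\kappa_j^{n+1,M}=e_j^{n+1,M}-\frac12(|E_{1,j}^{n+1}|^2+|E_{2,j}^{n+1}|^2+|B_{3,j}^{n+1}|^2)$, and $$(\mathbf f_1^M)_j=\mathbf w\star\left(\tfrac{\rho_j^{n+1,M}}{c_1^2}\mathbf V_1+\tfrac{J_{1,j}^{n+1,M}}{c_1c_2}\mathbf V_2+\tfrac{J_{2,j}^{n+1,M}}{c_1c_2}\mathbf V_3+\tfrac{\sqrt2}{c_1c_3}\left(\kappa_j^{n+1,M}-c\,\rho_j^{n+1,M}\right)\mathbf V_4\right).$$ 6. *Update.* $\mathbf f^{n+1}=\mathbf f_1^M+(I-P_{\mathcal N})\left(\sqrt{\mathbf w}\star\mathcal T_\varepsilon\left(\frac1{\sqrt{\mathbf w}}\star\mathbf f_2\right)\right)$. *)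

(* Defs.v *)
From HB Require Import structures.
From mathcomp Require Import all_boot all_order all_algebra.
From mathcomp Require Import all_classical all_reals all_analysis.

Set Implicit Arguments.
Unset Strict Implicit.
Unset Printing Implicit Defensive.

Import Order.TTheory GRing.Theory Num.Theory.
Import numFieldNormedType.Exports.

Local Open Scope ring_scope.

Section SpectralDifferentiation.
Context {R : realType}.

(* The trigonometric cardinal function of N equispaced nodes of mesh size h,
   of period N * h: it is 1 at 0 and 0 at the other nodes k * h. For even N
   the Nyquist mode k = N / 2 enters with half the weight of the others. *)
Definition trig_cardinal (N : nat) (h x : R) : R :=
  N%:R^-1 * (1 + 2 * (\sum_(1 <= k < uphalf N) cos (2 * pi * k%:R * x / (N%:R * h)))
             + (if odd N then 0 else cos (pi * x / h))).

Definition trig_interpolant (N : nat) (h : R) (u : 'I_N -> R) (x : R) : R :=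
  \sum_(m < N) u m * trig_cardinal N h (x - m%:R * h).

(* Fourier collocation differentiation: differentiate the trigonometric
   interpolant and sample the derivative at the nodes. The matrix depends only
   on differences of nodes, so the origin of the grid is immaterial. *)
Definition spectral_diff (N : nat) (h : R) (u : 'I_N -> R) (j : 'I_N) : R :=
  derive1 (trig_interpolant h u) (j%:R * h).

End SpectralDifferentiation.

Section VelocityGrid.
Context {R : realType}.

Definition vmesh (Nv : nat) (vmax : R) : R := 2 * vmax / Nv.-1%:R.

(* Both velocity directions share this grid of [-vmax, vmax]. *)
Definition vgrid (Nv : nat) (vmax : R) : 'cV[R]_Nv :=
  \col_i (- vmax + i%:R * vmesh Nv vmax).

Definition ones (Nv : nat) : 'cV[R]_Nv := const_mx 1.

Definition powv (Nv : nat) (a : 'cV[R]_Nv) (k : nat) : 'cV[R]_Nv :=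
  map_mx (fun x => x ^+ k) a.

Definition outer (Nv : nat) (a b : 'cV[R]_Nv) : 'M[R]_Nv := a *m b^T.

Definition star (Nv : nat) (g h : 'M[R]_Nv) : 'M[R]_Nv := map2_mx *%R g h.

Section Weighted.
Context (Nv : nat) (vmax : R) (w1 : R -> R).

Let v := vgrid Nv vmax.
Let e := ones Nv.

Definition inner (g h : 'M[R]_Nv) : R :=
  vmesh Nv vmax * vmesh Nv vmax * \sum_i \sum_j g i j * h i j.

Definition weight1 : 'cV[R]_Nv := map_mx w1 v.
Definition weight : 'M[R]_Nv := outer weight1 weight1.

Definition inner_w (g h : 'M[R]_Nv) : R := inner (star weight g) h.

Definition inner_w1 (a b : 'cV[R]_Nv) : R :=
  vmesh Nv vmax * \sum_i a i 0 * b i 0 * weight1 i 0.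

Definition norm_w1 (a : 'cV[R]_Nv) : R := Num.sqrt (inner_w1 a a).

Definition cmean : R := inner_w1 e (powv v 2) / inner_w1 e e.
Definition c1 : R := norm_w1 e.
Definition c2 : R := norm_w1 v.
Definition c3 : R := norm_w1 (powv v 2 - cmean *: e).

Definition V1 : 'M[R]_Nv := (c1 ^+ 2)^-1 *: outer e e.
Definition V2 : 'M[R]_Nv := (c1 * c2)^-1 *: outer v e.
Definition V3 : 'M[R]_Nv := (c1 * c2)^-1 *: outer e v.
Definition V4 : 'M[R]_Nv := (Num.sqrt 2 * c1 * c3)^-1 *:
  (outer (powv v 2 - cmean *: e) e + outer e (powv v 2 - cmean *: e)).

Definition Vbasis : 4.-tuple 'M[R]_Nv := [tuple V1; V2; V3; V4].

Definition Nspace : {vspace 'M[R]_Nv} :=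
  span [:: outer e e; outer v e; outer e v; outer (powv v 2) e + outer e (powv v 2)].

Definition orthonormal_basis_N : Prop :=
  basis_of Nspace Vbasis /\
  forall l m : 'I_4, inner_w (tnth Vbasis l) (tnth Vbasis m) = (l == m)%:R.

Definition projN (g : 'M[R]_Nv) : 'M[R]_Nv :=
  \sum_(l < 4) inner g (tnth Vbasis l) *: star weight (tnth Vbasis l).

Definition mul_sqrtw (g : 'M[R]_Nv) : 'M[R]_Nv := star (map_mx Num.sqrt weight) g.
Definition div_sqrtw (g : 'M[R]_Nv) : 'M[R]_Nv :=
  star (map_mx (fun x => (Num.sqrt x)^-1) weight) g.

End Weighted.

Definition exponentially_decaying (w1 : R -> R) : Prop :=
  exists C a : R, 0 < a /\ forall x, w1 x <= C * expR (- a * `|x|).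

End VelocityGrid.

(* A tensor of shape Nx * Nv * Nv is given by its slices f_j. *)
Definition tensor (R : realType) (Nx Nv : nat) : Type := 'I_Nx -> 'M[R]_Nv.

Section HierarchicalTucker.
Context {R : realType}.

(* Hierarchical Tucker format for the tree {(1,2,3); (1), (2,3); (2), (3)}:
   frames at the leaves, transfer tensors at (2,3) and at the root. *)
Record htensor (Nx Nv : nat) : Type := HTensor {
  rank1 : nat; rank2 : nat; rank3 : nat; rank23 : nat;
  frame1 : 'M[R]_(Nx, rank1);
  frame2 : 'M[R]_(Nv, rank2);
  frame3 : 'M[R]_(Nv, rank3);
  transfer23 : 'I_rank23 -> 'M[R]_(rank2, rank3);
  transfer_root : 'M[R]_(rank1, rank23)
}.
Arguments transfer23 {Nx Nv} h b.

Definition ht_full (Nx Nv : nat) (T : htensor Nx Nv) : tensor R Nx Nv := fun j =>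
  \sum_(a < rank1 T) \sum_(b < rank23 T)
    (frame1 T j a * transfer_root T a b) *:
      (frame2 T *m transfer23 T b *m (frame3 T)^T).

(* Matricizations: the rows are indexed by the dimensions of the tree node. *)
Definition unfold1 (Nx Nv : nat) (A : tensor R Nx Nv) : 'M[R]_(Nx, Nv * Nv) :=
  \matrix_j mxvec (A j).
Definition unfold23 (Nx Nv : nat) (A : tensor R Nx Nv) : 'M[R]_(Nv * Nv, Nx) :=
  (unfold1 A)^T.
Definition unfold2 (Nx Nv : nat) (A : tensor R Nx Nv) : 'M[R]_(Nv, Nx * Nv) :=
  \matrix_a mxvec (\matrix_(j, b) A j a b).
Definition unfold3 (Nx Nv : nat) (A : tensor R Nx Nv) : 'M[R]_(Nv, Nx * Nv) :=
  \matrix_b mxvec (\matrix_(j, a) A j a b).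

Definition rect_diag (m p : nat) (s : nat -> R) : 'M[R]_(m, p) :=
  \matrix_(i, j) (if i == j :> nat then s i else 0).

Definition is_svd (m p : nat) (M : 'M[R]_(m, p))
    (Q : 'M[R]_m) (s : nat -> R) (P : 'M[R]_p) : Prop :=
  [/\ Q^T *m Q = 1%:M, P^T *m P = 1%:M,
      (forall i, 0 <= s i), (forall i k, (i <= k)%N -> s k <= s i) &
      M = Q *m rect_diag m p s *m P^T].

(* l2 norm of the singular values discarded at rank r *)
Definition sv_tail (m p : nat) (s : nat -> R) (r : nat) : R :=
  Num.sqrt (\sum_(r <= i < minn m p) s i ^+ 2).

(* U collects the r leading left singular vectors of M, where r is the least
   rank for which the discarded singular values have l2 norm at most tol. *)
Definition truncated_frame (tol : R) (m p r : nat)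
    (M : 'M[R]_(m, p)) (U : 'M[R]_(m, r)) : Prop :=
  exists (Q : 'M[R]_m) (s : nat -> R) (P : 'M[R]_p),
  [/\ is_svd M Q s P,
      (r <= minn m p)%N,
      sv_tail m p s r <= tol,
      (forall r' : nat, (r' < r)%N -> tol < sv_tail m p s r') &
      (forall (i k : 'I_m) (a : 'I_r), a = k :> nat -> U i a = Q i k)].

(* Hierarchical SVD truncation of A to the format above, with the usual
   tolerance eps / sqrt (2 d - 3) per node (d = 3), so that the total error in
   the Frobenius norm is at most eps. *)
Definition hosvd_truncation (eps : R) (Nx Nv : nat)
    (A : tensor R Nx Nv) (T : htensor Nx Nv) : Prop :=
  let tol := eps / Num.sqrt 3 in
  exists U23 : 'M[R]_(Nv * Nv, rank23 T),
  [/\ truncated_frame tol (unfold1 A) (frame1 T),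
      truncated_frame tol (unfold2 A) (frame2 T) /\
      truncated_frame tol (unfold3 A) (frame3 T),
      truncated_frame tol (unfold23 A) U23,
      (forall b, transfer23 T b
         = (frame2 T)^T *m vec_mx (col b U23)^T *m frame3 T) &
      transfer_root T = (frame1 T)^T *m unfold1 A *m U23].

End HierarchicalTucker.
Arguments htensor R Nx Nv : clear implicits.

Section Solver.
Context {R : realType}.

Definition col4 (x0 x1 x2 x3 : R) : 'cV[R]_4 := \col_i [:: x0; x1; x2; x3]`_i.

(* The data held by the solver at one time level; macro contains the stored
   values U^M = (rho, P1, P2, e). *)
Record level (Nx Nv : nat) : Type := Level {
  distr : htensor R Nx Nv;
  E1 : 'I_Nx -> R;
  E2 : 'I_Nx -> R;
  B3 : 'I_Nx -> R;
  macro : 'I_Nx -> 'cV[R]_4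
}.

Section Scheme.
Context (Nx Nv : nat) (hx vmax : R) (w1 : R -> R) (rhoi dt : R).

Let v := vgrid Nv vmax.
Let e := ones (R := R) Nv.
Let hv := vmesh Nv vmax.
Let f (s : level Nx Nv) : tensor R Nx Nv := ht_full (distr s).

Definition charge_density (s : level Nx Nv) (j : 'I_Nx) : R :=
  inner vmax (f s j) (outer e e).
Definition current1 (s : level Nx Nv) (j : 'I_Nx) : R :=
  inner vmax (f s j) (outer v e).
Definition current2 (s : level Nx Nv) (j : 'I_Nx) : R :=
  inner vmax (f s j) (outer e v).
Definition kinetic_energy (s : level Nx Nv) (j : 'I_Nx) : R :=
  2^-1 * inner vmax (f s j) (outer (powv v 2) e + outer e (powv v 2)).

(* U_j, computed from the distribution tensor and the fields (and not from the
   stored values) *)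
Definition macro_of (s : level Nx Nv) (j : 'I_Nx) : 'cV[R]_4 :=
  col4 (charge_density s j)
       (current1 s j + E2 s j * B3 s j)
       (current2 s j - E1 s j * B3 s j)
       (kinetic_energy s j + 2^-1 * (E1 s j ^+ 2 + E2 s j ^+ 2 + B3 s j ^+ 2)).

Definition Dx1 (g : tensor R Nx Nv) : tensor R Nx Nv := fun j =>
  \matrix_(a, b) spectral_diff hx (fun i => g i a b) j.
Definition Dv1 (g : 'M[R]_Nv) : 'M[R]_Nv :=
  \matrix_(a, b) spectral_diff hv (fun i => g i b) a.
Definition Dv2 (g : 'M[R]_Nv) : 'M[R]_Nv :=
  \matrix_(a, b) spectral_diff hv (fun i => g a i) b.

(* f^{n+1,*} from the levels s2 = n - 2 and s = n *)
Definition add_basis (s2 s : level Nx Nv) : tensor R Nx Nv := fun j =>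
  4^-1 *: f s2 j + (3 / 4) *: f s j
  - (3 / 2 * dt) *:
    (star (outer v e) (Dx1 (f s) j)
     + E1 s j *: Dv1 (f s j)
     + star (outer e v) (B3 s j *: Dv1 (f s j))
     + E2 s j *: Dv2 (f s j)
     - star (outer v e) (B3 s j *: Dv2 (f s j))).

Definition remainder (s2 s : level Nx Nv) : tensor R Nx Nv := fun j =>
  add_basis s2 s j - projN vmax w1 (add_basis s2 s j).

Definition truncated_remainder (Teps : tensor R Nx Nv -> htensor R Nx Nv)
    (s2 s : level Nx Nv) : tensor R Nx Nv := fun j =>
  let g := mul_sqrtw vmax w1
    (ht_full (Teps (fun i => div_sqrtw vmax w1 (remainder s2 s i))) j) in
  g - projN vmax w1 g.

Definition vplus : 'cV[R]_Nv := map_mx (fun x => Num.max x 0) v.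
Definition vminus : 'cV[R]_Nv := map_mx (fun x => Num.min x 0) v.

Definition split_flux (u : 'cV[R]_Nv) (s : level Nx Nv) (j : 'I_Nx) : 'cV[R]_4 :=
  col4 (inner vmax (f s j) (outer u e))
       (inner vmax (f s j) (outer (powv u 2) e))
       (inner vmax (f s j) (outer u v))
       (inner vmax (f s j)
          (2^-1 *: outer (powv u 3) e + 2^-1 *: outer u (powv v 2))).

(* periodic shifts by k grid points to the right and to the left *)
Let right k : 'I_Nx -> 'I_Nx := iter k (@ordS Nx).
Let left k : 'I_Nx -> 'I_Nx := iter k (@ord_pred Nx).

(* Fluxes at the interface j + 1/2; the one at j - 1/2 is
   num_flux s (ord_pred j). *)
Definition num_flux_plus (s : level Nx Nv) (j : 'I_Nx) : 'cV[R]_4 :=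
  let F := split_flux vplus s in
  (1 / 30) *: F (left 2 j) - (13 / 60) *: F (left 1 j) + (47 / 60) *: F j
  + (9 / 20) *: F (right 1 j) - (1 / 20) *: F (right 2 j).
Definition num_flux_minus (s : level Nx Nv) (j : 'I_Nx) : 'cV[R]_4 :=
  let F := split_flux vminus s in
  - (1 / 20) *: F (left 1 j) + (9 / 20) *: F j + (47 / 60) *: F (right 1 j)
  - (13 / 60) *: F (right 2 j) + (1 / 30) *: F (right 3 j).
Definition num_flux (s : level Nx Nv) (j : 'I_Nx) : 'cV[R]_4 :=
  num_flux_plus s j + num_flux_minus s j.

Definition source (s : level Nx Nv) (j : 'I_Nx) : 'cV[R]_4 :=
  col4 0
    (2^-1 * spectral_diff hx (fun i => E1 s i ^+ 2 - E2 s i ^+ 2 - B3 s i ^+ 2) j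
       + rhoi * E1 s j)
    (spectral_diff hx (fun i => E1 s i * E2 s i) j + rhoi * E2 s j)
    (spectral_diff hx (fun i => E2 s i * B3 s i) j).

(* Right-hand side of the macroscopic scheme, for the values U2 at level n - 2
   and U at level n. *)
Definition macro_update (U2 U : 'cV[R]_4) (s : level Nx Nv) (j : 'I_Nx) : 'cV[R]_4 :=
  4^-1 *: U2 + (3 / 4) *: U
  + (3 / 2 * dt) *:
    (- hx^-1 *: (num_flux s j - num_flux s (ord_pred j)) + source s j).

(* f_1^M, from the stored values and the fields of s *)
Definition correction (s : level Nx Nv) : tensor R Nx Nv := fun j =>
  let c := cmean Nv vmax w1 in
  let c1 := c1 Nv vmax w1 in
  let c2 := c2 Nv vmax w1 in
  let c3 := c3 Nv vmax w1 in
  let rhoM := macro s j 0 0 in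
  let J1M := macro s j 1 0 - E2 s j * B3 s j in
  let J2M := macro s j 2 0 + E1 s j * B3 s j in
  let kappaM := macro s j 3 0 - 2^-1 * (E1 s j ^+ 2 + E2 s j ^+ 2 + B3 s j ^+ 2) in
  star (weight Nv vmax w1)
    ((rhoM / c1 ^+ 2) *: V1 Nv vmax w1
     + (J1M / (c1 * c2)) *: V2 Nv vmax w1
     + (J2M / (c1 * c2)) *: V3 Nv vmax w1
     + (Num.sqrt 2 / (c1 * c3) * (kappaM - c * rhoM)) *: V4 Nv vmax w1).

(* One step from the levels s2 = n - 2 and s = n to s' = n + 1; hist is the
   list of all the levels 0, ..., n. *)
Definition lomac_step (Teps : tensor R Nx Nv -> htensor R Nx Nv)
    (gauss : ('I_Nx -> R) -> ('I_Nx -> R))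
    (maxwell : seq (level Nx Nv) -> ('I_Nx -> 'cV[R]_4) -> ('I_Nx -> R) ->
               ('I_Nx -> R) * ('I_Nx -> R))
    (hist : seq (level Nx Nv)) (s2 s s' : level Nx Nv) : Prop :=
  [/\ (forall j, macro s' j = macro_update (macro s2 j) (macro s j) s j),
      E1 s' = gauss (fun j => macro s' j 0 0),
      (E2 s', B3 s') = maxwell hist (macro s') (E1 s') &
      (forall j, f s' j = correction s' j + truncated_remainder Teps s2 s j)].

End Scheme.

(* solve is a solver of the discrete Gauss law d E = rho - rhoi, where the
   matrix d discretizes the derivative in x1 (hence kills constants). On a
   periodic grid this is not solvable for every rho, and nothing is required of
   the solver when it is not. *)
Definition gauss_solver (Nx : nat) (rhoi : R) (d : 'M[R]_Nx)
    (solve : ('I_Nx -> R) -> ('I_Nx -> R)) : Prop :=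
  let gauss_law rho E := forall j : 'I_Nx, \sum_k d j k * E k = rho j - rhoi in
  d *m const_mx 1 = 0 :> 'cV[R]_Nx /\
  forall rho, (exists E, gauss_law rho E) -> gauss_law rho (solve rho).

(* A run of the solver. The update of E2 and B3 by Maxwell's equations is any
   map from the past levels, the new macroscopic values and the new E1. *)
Definition lomac_run (Nx Nv : nat) (hx vmax : R) (w1 : R -> R) (rhoi dt : R)
    (Teps : tensor R Nx Nv -> htensor R Nx Nv)
    (gauss : ('I_Nx -> R) -> ('I_Nx -> R))
    (maxwell : seq (level Nx Nv) -> ('I_Nx -> 'cV[R]_4) -> ('I_Nx -> R) ->
               ('I_Nx -> R) * ('I_Nx -> R))
    (s : nat -> level Nx Nv) : Prop :=
  (forall m, (m <= 2)%N -> forall j, macro (s m) j = macro_of vmax (s m) j) /\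
  (forall n, (2 <= n)%N ->
     lomac_step hx vmax w1 rhoi dt Teps gauss maxwell
       (mkseq s n.+1) (s (n - 2)%N) (s n) (s n.+1)).

End Solver.
Arguments level R Nx Nv : clear implicits.

(* Main.v *)
Require Import Defs.
From HB Require Import structures.
From mathcomp Require Import all_boot all_order all_algebra.
From mathcomp Require Import all_classical all_reals all_analysis.
From mathcomp Require Import ring.

(** Conservation holds because the stored macroscopic values obey the
flux-difference scheme by construction, so that it suffices to show that they
are the macroscopic values of the distribution tensor: [macro s j = macro_of s
j] at every level. The levels 0, 1, 2 satisfy this by assumption, and any later
level is the sum of two tensors whose moments are controlled separately.

The truncated remainder has the form [g - projN g]. By orthonormality of the
[V_l] in the weighted product, the projection preserves the products with the
[V_l] ([inner_projN]), whatever [g] is. The remainder therefore contributes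
nothing to mass, momentum and energy, however coarse the low rank truncation
inside [g] may be.

The correction is [w * sum_l a_l V_l], and the same orthonormality gives it
product [a_l] with [V_l] ([inner_weight_comb]). The densities are, up to the
normalizing constants, the products with [V_1], [V_2], [V_3] and a combination
of those with [V_4] and [V_1]; the coefficients [a_l] are chosen to
invert this relation ([correction_macro_of]). The field terms
subtracted from the stored momenta and energy in the correction are those added
back in [macro_of]. *)

Set Implicit Arguments.
Unset Strict Implicit.
Unset Printing Implicit Defensive.

Import Order.TTheory GRing.Theory Num.Theory.
Import numFieldNormedType.Exports.

Local Open Scope ring_scope.

Section InnerProduct.
Context {R : realType} (Nv : nat) (vmax : R).
Implicit Types g h : 'M[R]_Nv.

Lemma innerC g h : inner vmax g h = inner vmax h g.
Proof.
by rewrite /inner; congr (_ * _); do 2!apply: eq_bigr => ? _; rewrite mulrC.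
Qed.

Lemma innerDl g1 g2 h : inner vmax (g1 + g2) h = inner vmax g1 h + inner vmax g2 h.
Proof.
rewrite /inner -mulrDr -big_split; congr (_ * _); apply: eq_bigr => i _ /=.
by rewrite -big_split; apply: eq_bigr => j _; rewrite mxE mulrDl.
Qed.

Lemma innerZl a g h : inner vmax (a *: g) h = a * inner vmax g h.
Proof.
rewrite /inner [RHS]mulrCA; congr (_ * _); rewrite mulr_sumr.
apply: eq_bigr => i _; rewrite mulr_sumr.
by apply: eq_bigr => j _; rewrite mxE mulrA.
Qed.

Lemma innerDr g h1 h2 : inner vmax g (h1 + h2) = inner vmax g h1 + inner vmax g h2.
Proof. by rewrite innerC innerDl !(innerC g). Qed.

Lemma innerZr a g h : inner vmax g (a *: h) = a * inner vmax g h.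
Proof. by rewrite innerC innerZl (innerC g). Qed.

Lemma innerBl g1 g2 h : inner vmax (g1 - g2) h = inner vmax g1 h - inner vmax g2 h.
Proof. by rewrite innerDl -scaleN1r innerZl mulN1r. Qed.

Lemma inner0l h : inner vmax 0 h = 0.
Proof. by rewrite -(scale0r 0) innerZl mul0r. Qed.

Lemma inner_suml I (r : seq I) (F : I -> 'M[R]_Nv) h :
  inner vmax (\sum_(i <- r) F i) h = \sum_(i <- r) inner vmax (F i) h.
Proof.
by elim/big_rec2: _ => [|i x y _ <-]; rewrite ?inner0l ?innerDl.
Qed.

Lemma starDr u g h : star u (g + h) = star u g + star u h.
Proof. by apply/matrixP => i j; rewrite !mxE mulrDr. Qed.

Lemma starZr a u g : star u (a *: g) = a *: star u g.
Proof. by apply/matrixP => i j; rewrite !mxE mulrCA. Qed.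

Lemma star0r u : star u 0 = 0 :> 'M[R]_Nv.
Proof. by apply/matrixP => i j; rewrite !mxE mulr0. Qed.

End InnerProduct.

Section Projection.
Context {R : realType} (Nv : nat) (vmax : R) (w1 : R -> R).
Context (V_basis : orthonormal_basis_N Nv vmax w1).

Local Notation V := (Vbasis Nv vmax w1).
Local Notation W := (weight Nv vmax w1).

(** The weight in the combination turns the unweighted product into the one for
which the [V_l] are orthonormal, so testing against [V_m] reads off [a m]. *)
Lemma inner_weight_comb (a : 'I_4 -> R) m :
  inner vmax (\sum_l a l *: star W (tnth V l)) (tnth V m) = a m.
Proof.
rewrite inner_suml (bigD1 m) //= big1 => [|l lm]; rewrite innerZl.
  by have /= := V_basis.2 m m; rewrite /inner_w => ->; rewrite eqxx mulr1 addr0.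
by have := V_basis.2 l m; rewrite /inner_w => ->; rewrite (negPf lm) mulr0.
Qed.

Lemma inner_projN g m :
  inner vmax (projN vmax w1 g) (tnth V m) = inner vmax g (tnth V m).
Proof. exact: (inner_weight_comb (fun l => inner vmax g (tnth V l))). Qed.

Lemma Vbasis_neq0 l : tnth V l != 0.
Proof.
apply/eqP => Vl0; have := V_basis.2 l l.
rewrite Vl0 /inner_w star0r inner0l eqxx => /esym/eqP.
by rewrite oner_eq0.
Qed.

(** The inverse of [0] being [0], a vanishing norm would make some [V_l] vanish,
against orthonormality. *)
Lemma norms_neq0 :
  [/\ c1 Nv vmax w1 != 0, c2 Nv vmax w1 != 0 & c3 Nv vmax w1 != 0].
Proof.
have := Vbasis_neq0 (inord 1); have := Vbasis_neq0 (inord 3).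
rewrite !(tnth_nth 0) !inordK //= /V2 /V4 !scaler_eq0 !invr_eq0 !mulf_eq0.
by rewrite !negb_or => /andP[/andP[/andP[_ ->] ->]] _ /andP[/andP[_ ->]].
Qed.

Local Notation e := (ones (R := R) Nv).
Local Notation v := (vgrid Nv vmax).
Local Notation c := (cmean Nv vmax w1).
Local Notation C1 := (c1 Nv vmax w1).
Local Notation C2 := (c2 Nv vmax w1).
Local Notation C3 := (c3 Nv vmax w1).

Lemma mass_testE : outer e e = C1 ^+ 2 *: V1 Nv vmax w1.
Proof.
by have [c1N0 _ _] := norms_neq0; rewrite /V1 scalerA divff ?scale1r ?expf_neq0.
Qed.

Lemma momentum1_testE : outer v e = (C1 * C2) *: V2 Nv vmax w1.
Proof.
by have [c1N0 c2N0 _] := norms_neq0; rewrite /V2 scalerA divff ?scale1r ?mulf_neq0.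
Qed.

Lemma momentum2_testE : outer e v = (C1 * C2) *: V3 Nv vmax w1.
Proof.
by have [c1N0 c2N0 _] := norms_neq0; rewrite /V3 scalerA divff ?scale1r ?mulf_neq0.
Qed.

Lemma energy_testE :
  outer (powv v 2) e + outer e (powv v 2)
  = (Num.sqrt 2 * C1 * C3) *: V4 Nv vmax w1 + (2 * c * C1 ^+ 2) *: V1 Nv vmax w1.
Proof.
have [c1N0 _ c3N0] := norms_neq0.
have sqrt2N0 : Num.sqrt 2 != 0 :> R by rewrite gt_eqF // sqrtr_gt0 ltr0n.
rewrite -(scalerA (2 * c)) -mass_testE /V4 scalerA divff ?scale1r ?mulf_neq0 //.
apply/matrixP => i j; rewrite !mxE !big_ord1 !mxE; ring.
Qed.

(** The coefficients in the correction invert the relation between the moments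
and the products with the [V_l]. [V_4] is made of [v ^ 2 - c] rather than of
[v ^ 2], whence the shift by [- c * rho] of its coefficient. *)
Lemma correction_macro_of (Nx : nat) (s : level R Nx Nv) (g : 'M[R]_Nv) j :
  ht_full (distr s) j = correction vmax w1 s j + (g - projN vmax w1 g) ->
  macro_of vmax s j = macro s j.
Proof.
move=> fE; have [c1N0 c2N0 c3N0] := norms_neq0.
have sqrt2K : Num.sqrt 2 ^+ 2 = 2 :> R by rewrite sqr_sqrtr ?ler0n.
pose rhoM := macro s j 0 0.
pose J1M := macro s j 1 0 - E2 s j * B3 s j.
pose J2M := macro s j 2 0 + E1 s j * B3 s j.
pose kM := macro s j 3 0 - 2^-1 * (E1 s j ^+ 2 + E2 s j ^+ 2 + B3 s j ^+ 2).
pose a (l : 'I_4) := [:: rhoM / C1 ^+ 2; J1M / (C1 * C2); J2M / (C1 * C2);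
                         Num.sqrt 2 / (C1 * C3) * (kM - c * rhoM)]`_l.
have corrE : correction vmax w1 s j = \sum_l a l *: star W (tnth V l).
  rewrite /correction !big_ord_recl big_ord0 addr0 !addrA !starDr.
  by rewrite !starZr.
have fV l : inner vmax (ht_full (distr s) j) (tnth V l) = a l.
  by rewrite fE innerDl innerBl inner_projN subrr addr0 corrE inner_weight_comb.
have fV1 : inner vmax (ht_full (distr s) j) (V1 Nv vmax w1) = rhoM / C1 ^+ 2.
  exact: (fV 0).
have fV2 : inner vmax (ht_full (distr s) j) (V2 Nv vmax w1) = J1M / (C1 * C2).
  exact: (fV 1).
have fV3 : inner vmax (ht_full (distr s) j) (V3 Nv vmax w1) = J2M / (C1 * C2).
  exact: (fV 2).
have fV4 : inner vmax (ht_full (distr s) j) (V4 Nv vmax w1)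
           = Num.sqrt 2 / (C1 * C3) * (kM - c * rhoM).
  exact: (fV 3).
have rhoE : charge_density vmax s j = rhoM.
  by rewrite /charge_density mass_testE innerZr fV1 mulrC divfK ?expf_neq0.
have J1E : current1 vmax s j = J1M.
  by rewrite /current1 momentum1_testE innerZr fV2 mulrC divfK ?mulf_neq0.
have J2E : current2 vmax s j = J2M.
  by rewrite /current2 momentum2_testE innerZr fV3 mulrC divfK ?mulf_neq0.
have kE : kinetic_energy vmax s j = kM.
  rewrite /kinetic_energy energy_testE innerDr.
  rewrite (innerZr _ (Num.sqrt 2 * C1 * C3)) (innerZr _ (2 * c * C1 ^+ 2)) fV1 fV4.
  have -> : Num.sqrt 2 * C1 * C3 * (Num.sqrt 2 / (C1 * C3) * (kM - c * rhoM))
            = Num.sqrt 2 ^+ 2 * (kM - c * rhoM).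
    by field; rewrite c1N0 c3N0.
  by rewrite sqrt2K; field; rewrite c1N0.
apply/colP => -[i lti4]; rewrite /macro_of mxE rhoE J1E J2E kE.
case: i lti4 => [|[|[|[|//]]]] lti4 /=.
- by rewrite /rhoM; congr (macro s j _ _); apply: val_inj.
- by rewrite subrK; congr (macro s j _ _); apply: val_inj.
- by rewrite addrK; congr (macro s j _ _); apply: val_inj.
- by rewrite subrK; congr (macro s j _ _); apply: val_inj.
Qed.

End Projection.

Theorem proposition2p1 (R : realType) (Nx Nv : nat) (hx vmax rhoi dt eps : R)
  (w1 : R -> R)
  (Nx_gt0 : (0 < Nx)%N) (Nv_gt1 : (1 < Nv)%N)
  (hx_gt0 : 0 < hx) (vmax_gt0 : 0 < vmax) (dt_gt0 : 0 < dt) (eps_ge0 : 0 <= eps)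
  (w1_gt0 : forall x, 0 < w1 x) (w1_decay : exponentially_decaying w1)
  (V_basis : orthonormal_basis_N Nv vmax w1)
  (Teps : tensor R Nx Nv -> htensor R Nx Nv)
  (Teps_hosvd : forall A, hosvd_truncation eps A (Teps A))
  (d : 'M[R]_Nx) (gauss : ('I_Nx -> R) -> ('I_Nx -> R))
  (gaussP : gauss_solver rhoi d gauss)
  (maxwell : seq (level R Nx Nv) -> ('I_Nx -> 'cV[R]_4) -> ('I_Nx -> R) ->
             ('I_Nx -> R) * ('I_Nx -> R))
  (s : nat -> level R Nx Nv)
  (s_run : lomac_run hx vmax w1 rhoi dt Teps gauss maxwell s) :
  forall n : nat, (2 <= n)%N -> forall j : 'I_Nx,
    macro_of vmax (s n.+1) j =
      4^-1 *: macro_of vmax (s (n - 2)%N) j + (3 / 4) *: macro_of vmax (s n) j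
      + (3 / 2 * dt) *:
        (- hx^-1 *: (num_flux vmax (s n) j - num_flux vmax (s n) (ord_pred j))
         + source hx rhoi (s n) j).
Proof.
have [init step] := s_run.
have stored m j : macro_of vmax (s m) j = macro (s m) j.
  have [m2|m3] := leqP m 2; first by rewrite init.
  case: m m3 => [//|m] m2; have [_ _ _ fE] := step m m2.
  exact: (correction_macro_of V_basis (fE j)).
by move=> n n2 j; rewrite !stored; have [macroE _ _ _] := step n n2; rewrite macroE.
Qed.
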